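(* Let $\mathcal{P} \subset \Delta(\mathcal{S})^{\mathcal{S}\times\mathcal{A}}$ be a nonempty compact (not necessarily convex) uncertainty set. The following three statements are equivalent. 1. ($\mathcal{P}$ is sa-tractable.) For all $\pi \in \Pi_{\mathsf S}$, all $r \in \mathbb{R}^{\mathcal{S}\times\mathcal{A}\times\mathcal{S}}$, all $\gamma \in [0,1)$ and all $\mu \in \Delta(\mathcal{S})$, $$\min_{P \in \mathcal{P}} \mu^\top v^{\pi,P} = \mu^\top \hat u^{\pi}.$$ 2. For all $\pi \in \Pi_{\mathsf S}$, all $r \in \mathbb{R}^{\mathcal{S}\times\mathcal{A}\times\mathcal{S}}$ and all $\gamma \in [0,1)$, there exists $\hat P \in \mathcal{P}$ such that $\hat u^{\pi} = v^{\pi,\hat P}$. 3. For all $V \in \mathbb{R}^{\mathcal{S}\times\mathcal{A}\times\mathcal{S}}$, $$\bigcap_{(s,a) \in \mathcal{S}\times\mathcal{A}} \arg\min_{P \in \mathcal{P}} \langle P_{sa}, V_{sa}\rangle \neq \emptyset .$$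
   Context: $\mathcal{S}$ (states) and $\mathcal{A}$ (actions) are finite nonempty sets; $\Delta(E)$ denotes the set of probability distributions on a finite set $E$. An uncertainty set is a subset $\mathcal{P} \subset \Delta(\mathcal{S})^{\mathcal{S}\times\mathcal{A}}$; its elements are written $P=(P_{sa})_{(s,a)}$ with $P_{sa}\in\Delta(\mathcal{S})\subset\mathbb{R}^{\mathcal{S}}$. For $V\in\mathbb{R}^{\mathcal{S}\times\mathcal{A}\times\mathcal{S}}$, $V_{sa}=(V_{sas'})_{s'}\in\mathbb{R}^{\mathcal{S}}$; $\langle\cdot,\cdot\rangle$ is the usual scalar product. Stationary policies: $\Pi_{\mathsf S}=\Delta(\mathcal{A})^{\mathcal{S}}$, $\pi=(\pi_{sa})$. For rewards $r\in\mathbb{R}^{\mathcal{S}\times\mathcal{A}\times\mathcal{S}}$ (with $r_{sa}=(r_{sas'})_{s'}\in\mathbb{R}^{\mathcal{S}}$), discount factor $\gamma\in[0,1)$, $\pi\in\Pi_{\mathsf S}$ and $P\in\mathcal{P}$, the value function $v^{\pi,P}\in\mathbb{R}^{\mathcal{S}}$ is $v^{\pi,P}_s=\mathbb{E}^{\pi,P}\big[\sum_{t\ge 0}\gamma^t r_{s_ta_ts_{t+1}}\,\big|\,s_0=s\big]$ (with $0^0=1$), where $a_t\sim\pi_{s_t}$ and $s_{t+1}\sim P_{s_ta_t}$; equivalently it is the unique solution of $v_s=\sum_a\pi_{sa}P_{sa}^\top(r_{sa}+\gamma v)$ for all $s$. The vector $\hat u^{\pi}\in\mathbb{R}^{\mathcal{S}}$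 (depending on $\pi,r,\gamma,\mathcal{P}$) is the unique vector satisfying $\hat u^\pi_s=\sum_{a\in\mathcal{A}}\pi_{sa}\min_{P\in\mathcal{P}}P_{sa}^\top(r_{sa}+\gamma \hat u^\pi)$ for all $s\in\mathcal{S}$. *)

(* Defs.v *)
From HB Require Import structures.
From mathcomp Require Import all_boot all_order all_algebra.
From mathcomp Require Import all_classical all_reals all_analysis.

Set Implicit Arguments.
Unset Strict Implicit.
Unset Printing Implicit Defensive.

Import Order.TTheory GRing.Theory Num.Theory.
Import numFieldNormedType.Exports.

Local Open Scope classical_set_scope.
Local Open Scope ring_scope.

Definition is_dist (R : realType) (E : finType) (p : E -> R) : Prop :=
  (forall e, 0 <= p e) /\ \sum_e p e = 1.

Definition dotp (R : realType) (E : finType) (p q : E -> R) : R :=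
  \sum_e p e * q e.

(* Includes the claim that the minimum is attained. *)
Definition is_min (R : realType) (E : set R) (m : R) : Prop :=
  E m /\ lbound E m.

Definition argmin (R : realType) (T : Type) (D : set T) (f : T -> R) : set T :=
  [set x | D x /\ forall y, D y -> f x <= f y].

(* As S and A are finite, this is R^(S x A x S) with its Euclidean topology;
   P (s, a) is the vector P_sa. *)
Notation transitions R S A := {ptws (S * A)%type -> {ptws S -> R}}.

Definition is_kernel (R : realType) (S A : finType) (P : S * A -> S -> R) :
  Prop := forall sa, is_dist (P sa).

Definition is_policy (R : realType) (S A : finType) (pi : S -> A -> R) : Prop :=
  forall s, is_dist (pi s).

(* The event X_0 = x 0, Y_0 = y 0, ..., Y_(t-1) = y (t-1), X_t = x t. *)
Definition history (T : Type) (S A : finType) (X : nat -> T -> S)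
    (Y : nat -> T -> A) (t : nat) (x : nat -> S) (y : nat -> A) : set T :=
  [set w | (forall i, (i <= t)%N -> X i w = x i) /\
           (forall i, (i < t)%N -> Y i w = y i)].

(* X_t and Y_t are the state and the action at time t of the chain started at s:
   given the history up to X_t, Y_t has law pi (X_t), and given moreover Y_t,
   X_(t+1) has law P (X_t, Y_t). Conditional laws are written in product form. *)
Definition is_controlled_chain (R : realType) (S A : finType)
    (d : measure_display) (T : measurableType d) (Pr : probability T R)
    (pi : S -> A -> R) (P : S * A -> S -> R) (s : S)
    (X : nat -> T -> S) (Y : nat -> T -> A) : Prop :=
  [/\ (forall t x, measurable (X t @^-1` [set x])),
      (forall t a, measurable (Y t @^-1` [set a])),
      Pr (X 0%N @^-1` [set s]) = 1%E,
      (forall t x y,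
        Pr (history X Y t x y `&` Y t @^-1` [set y t]) =
        (Pr (history X Y t x y) * (pi (x t) (y t))%:E)%E) &
      (forall t x y,
        Pr (history X Y t.+1 x y) =
        (Pr (history X Y t x y `&` Y t @^-1` [set y t]) *
         (P (x t, y t) (x t.+1))%:E)%E)].

Definition discounted_return (R : realType) (S A : finType) (T : Type)
    (r : S * A -> S -> R) (gamma : R) (X : nat -> T -> S) (Y : nat -> T -> A)
    (w : T) : R :=
  limn (fun n => \sum_(0 <= t < n)
    gamma ^+ t * r (X t w, Y t w) (X t.+1 w)).

(* The expected discounted return from s, computed on any probability space
   carrying the controlled chain; it depends only on the law of the chain.
   The default 0 of xget is never reached for a policy pi, a kernel P and
   0 <= gamma < 1, since such a chain then exists. *)
Definition value (R : realType) (S A : finType) (r : S * A -> S -> R)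
    (gamma : R) (pi : S -> A -> R) (P : S * A -> S -> R) (s : S) : R :=
  xget 0 [set v | exists (d : measure_display) (T : measurableType d)
    (Pr : probability T R) (X : nat -> T -> S) (Y : nat -> T -> A),
    is_controlled_chain Pr pi P s X Y /\
    ('E_Pr[discounted_return r gamma X Y])%E = v%:E].

Definition is_uhat (R : realType) (S A : finType)
    (PP : set (transitions R S A)) (r : S * A -> S -> R) (gamma : R)
    (pi : S -> A -> R) (u : S -> R) : Prop :=
  forall s, exists2 m : A -> R,
    (forall a, is_min
      [set dotp (P (s, a)) (fun s' => r (s, a) s' + gamma * u s') | P in PP]
      (m a)) &
    u s = \sum_a pi s a * m a.

(* For 0 <= gamma < 1, pi a policy and PP a nonempty compact set of kernels,
   is_uhat has exactly one solution, so the default is never reached. *)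
Definition uhat (R : realType) (S A : finType)
    (PP : set (transitions R S A)) (r : S * A -> S -> R) (gamma : R)
    (pi : S -> A -> R) : S -> R :=
  xget (fun=> 0) [set u | is_uhat PP r gamma pi u].

Definition sa_tractable (R : realType) (S A : finType)
    (PP : set (transitions R S A)) : Prop :=
  forall (pi : S -> A -> R) (r : S * A -> S -> R) (gamma : R) (mu : S -> R),
    is_policy pi -> 0 <= gamma < 1 -> is_dist mu ->
    is_min [set dotp mu (value r gamma pi P) | P in PP]
           (dotp mu (uhat PP r gamma pi)).

(* Main.v *)
Require Import Defs.
From HB Require Import structures.
From mathcomp Require Import all_boot all_order all_algebra.
From mathcomp Require Import all_classical all_reals all_analysis.
From mathcomp Require Import measurable_realfun ring.

Import Order.TTheory GRing.Theory Num.Theory.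
Import numFieldNormedType.Exports.

Local Open Scope classical_set_scope.
Local Open Scope ring_scope.

(** Both [uhat] and [value] are solutions of one-step equations, and the three
    statements are compared through these equations.

    For a fixed kernel [P], [value r gamma pi P] is the only solution of the
    Bellman equation [is_bellman r gamma pi P] ([value_eq]).  If some kernel
    [P] of [PP] minimises all the products [dotp (P sa) (r sa + gamma * uhat)]
    at once, then [uhat] solves the Bellman equation of [P], hence is the value
    of [P]; this gives the second statement from the third.  Conversely, for
    [gamma = 0], [r = V] and [pi] uniform, the equality of [uhat] with the value
    of [P] says that two averages with positive weights agree, one of the
    minima over [PP] and one of the products [dotp (P sa) (V sa)], which are
    larger term by term; so they agree term by term and [P] attains every
    minimum.

    For the first statement, a comparison principle ([bellman_comparison])
    gives [uhat <= value r gamma pi P] pointwise for every [P] in [PP].  So the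
    minimum of [dotp mu (value r gamma pi P)] is [dotp mu uhat] as soon as a
    single kernel has value [uhat]; and conversely, if the minimum for the
    uniform [mu] is [dotp mu uhat], then a minimising kernel has value [uhat],
    because all weights of [mu] are positive.

    What remains is to tie the definitions to the equations.  The robust
    operator is a sup-norm contraction, its minima being attained because [PP]
    is compact, so [uhat] exists ([is_uhat_exists]); with [PP = [set P]] this
    also solves the Bellman equation of [P].  For a controlled chain and a
    Bellman solution [u], the process
      [sum_(t < n) gamma^t * reward_t + gamma^n * u (X_n)]
    has constant expectation [u s], and letting [n] grow yields
    [expected_discounted_return].  Finally a chain exists: all its transitions
    are drawn from one uniform variable, each draw leaving a fresh uniform
    variable independent of the past ([controlled_chain_of_uniform]). *)

Set Implicit Arguments.
Unset Strict Implicit.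

(** * Averages against a distribution *)

Lemma ler_dotp (R : realType) (E : finType) (p f g : E -> R) :
  is_dist p -> (forall e, f e <= g e) -> dotp p f <= dotp p g.
Proof. by case=> p0 _ fg; apply: ler_sum => e _; apply: ler_wpM2l. Qed.

Lemma dotpD (R : realType) (E : finType) (p f g : E -> R) :
  dotp p (fun e => f e + g e) = dotp p f + dotp p g.
Proof. by rewrite -big_split; apply: eq_bigr => e _; rewrite mulrDr. Qed.

Lemma dotpZ (R : realType) (E : finType) (p f : E -> R) (c : R) :
  dotp p (fun e => c * f e) = c * dotp p f.
Proof. by rewrite /dotp mulr_sumr; apply: eq_bigr => e _; rewrite mulrCA. Qed.

Lemma dotp_cst (R : realType) (E : finType) (p : E -> R) (c : R) :
  is_dist p -> dotp p (fun=> c) = c.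
Proof. by case=> _ p1; rewrite /dotp -mulr_suml p1 mul1r. Qed.

(** A nonnegative function with zero average vanishes where the weights are
    positive. *)
Lemma eq_dotp_full (R : realType) (E : finType) (p f g : E -> R) :
  (forall e, 0 < p e) -> (forall e, f e <= g e) -> dotp p f = dotp p g ->
  forall e, f e = g e.
Proof.
move=> p0 fg h.
have hn e : true -> 0 <= p e * (g e - f e).
  by move=> _; rewrite mulr_ge0 ?subr_ge0// ltW.
have s0 : \sum_e p e * (g e - f e) = 0.
  under eq_bigr do rewrite mulrBr.
  by rewrite sumrB -/(dotp p f) -/(dotp p g) h subrr.
move=> e; have := psumr_eq0P hn s0 (i:=e) isT.
by move/eqP; rewrite mulf_eq0 gt_eqF//= subr_eq0 => /eqP.
Qed.

Lemma uniform_dist (R : realType) (E : finType) :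
  (0 < #|E|)%N -> is_dist (fun _ : E => (#|E|%:R : R)^-1).
Proof.
move=> E0; split=> [e|]; first by rewrite invr_ge0 ler0n.
by rewrite sumr_const -[_ *+ _]mulr_natr mulVf// pnatr_eq0 -lt0n.
Qed.

Lemma continuous_dotp (R : realType) (T : topologicalType) (E : finType)
    (p : T -> E -> R) (V : E -> R) :
  (forall e, continuous (p ^~ e)) -> continuous (fun t => dotp (p t) V).
Proof.
move=> cp t; apply: (@cvg_big _ _ _ _ _ add_continuous) => e _.
by apply: cvgMr_tmp; exact: cp.
Qed.

(** * Existence of the robust value *)

(** Real matrices are complete for their sup norm; the contraction principle needs
    this as an instance on row vectors. *)
HB.instance Definition _ (R : realType) (m n : nat) :=
  Uniform_isComplete.Build 'M[R]_(m, n) (@cauchy_cvg 'M[R]_(m, n)).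

Section worst.
Context (R : realType) (S A : finType) (PP : set (transitions R S A)).
Hypotheses (PPk : forall P, PP P -> is_kernel P).
Hypotheses (PP0 : PP !=set0) (PPc : compact PP).

Definition worst (V : S -> R) (sa : S * A) : R :=
  inf [set dotp (P sa) V | P in PP].

Lemma worstP V sa : is_min [set dotp (P sa) V | P in PP] (worst V sa).
Proof.
have [|P PPP Pmin] :=
    @compact_EVT_min _ _ (fun P : transitions R S A => dotp (P sa) V) _ PP0 PPc.
  apply: continuous_subspaceT; apply: continuous_dotp => s' P.
  have c1 := @proj_continuous (S * A)%type (fun=> {ptws S -> R}) sa P.
  have c2 := @proj_continuous S (fun=> R) s' (P sa).
  exact: (cvg_comp _ _ c1 c2).
have isl : lbound [set dotp (P sa) V | P in PP] (dotp (P sa) V).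
  by move=> _ [Q PQ <-]; apply: Pmin; exact: mem_set.
have Pi : [set dotp (P sa) V | P in PP] (dotp (P sa) V).
  by exists P => //; exact: set_mem.
suff -> : worst V sa = dotp (P sa) V by [].
apply/eqP; rewrite eq_le lb_le_inf ?andbT//; last by exists (dotp (P sa) V).
by apply: ge_inf => //; exists (dotp (P sa) V).
Qed.

(** The minimiser for [V] is a competitor for [W]: taking a worst case is
    monotone and commutes with constants, hence does not expand the sup norm. *)
Lemma worst_le (V W : S -> R) M sa : (forall s, W s <= V s + M) ->
  worst W sa <= worst V sa + M.
Proof.
move=> VW; have [[P PPP <-] _] := worstP V sa; have [_ lb] := worstP W sa.
have Psa := PPk PPP sa.
apply: (@le_trans _ _ (dotp (P sa) W)); first by apply: lb; exists P.
by rewrite -[X in _ + X](dotp_cst M Psa) -dotpD; exact: ler_dotp.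
Qed.

(** The right-hand side of the equation of [uhat], written on row vectors to use
    their sup norm, is a [gamma]-contraction: its fixed point is [uhat]. *)
Lemma is_uhat_exists r gamma pi : 0 <= gamma < 1 -> is_policy pi ->
  exists u, is_uhat PP r gamma pi u.
Proof.
move=> /andP[g0 g1] pip.
pose un (x : 'rV[R]_#|S|) s : R := x ord0 (enum_rank s).
pose V (x : 'rV[R]_#|S|) sa s' := r sa s' + gamma * un x s'.
pose B x s := dotp (pi s) (fun a => worst (V x (s, a)) (s, a)).
pose F (x : 'rV[R]_#|S|) : 'rV[R]_#|S| := \row_i B x (enum_val i).
have unle x y s : un x s - un y s <= `|x - y|.
  rewrite (le_trans (ler_norm _))// /un.
  have -> : x ord0 (enum_rank s) - y ord0 (enum_rank s) =
    (x - y) ord0 (enum_rank s) by rewrite !mxE.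
  rewrite [leRHS]/Num.norm/= mx_normrE.
  by apply: (le_bigmax _ (fun ij => `|(x - y) ij.1 ij.2|) (ord0, enum_rank s)).
have BB x y s : B x s - B y s <= gamma * `|x - y|.
  rewrite lerBlDl -[X in _ + X](dotp_cst _ (pip s)) -dotpD.
  apply: ler_dotp => // a; apply: worst_le => s'.
  rewrite /V -addrA lerD2l -mulrDr ler_wpM2l//.
  by rewrite -lerBlDl unle.
have Fctr : is_contraction
    (mkfun_fun (fun x => fun=> I : [set: 'rV[R]_#|S|] (F x))
     : {fun [set: 'rV[R]_#|S|] >-> [set: 'rV[R]_#|S|]}).
  exists (NngNum g0); split=> // -[x y] _ /=.
  rewrite [leLHS]/Num.norm/= mx_normrE; apply/bigmax_leP; split=> [|ij _].
    by rewrite mulr_ge0.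
  rewrite !mxE /= ler_norml BB andbT lerNl opprB.
  by rewrite distrC BB.
have [x _ xF] :=
  @banach_fixed_point R 'rV[R]_#|S| _ _ Fctr closedT (ex_intro _ 0 I).
exists (un x) => s; exists (fun a => worst (V x (s, a)) (s, a)).
  by move=> a; exact: worstP.
by rewrite {1}xF /un mxE enum_rankK.
Qed.

End worst.

(** * Finite-valued random variables *)

Section fibers.
Context (d : measure_display) (T : measurableType d) (R : realType).
Context (Pr : probability T R).

Definition pr (B : set T) : R := fine (Pr B).

Lemma prE B : measurable B -> (pr B)%:E = Pr B.
Proof. by move=> mB; rewrite /pr fineK// fin_num_measure. Qed.

Lemma pr_ge0 B : 0 <= pr B. Proof. exact: fine_ge0. Qed.

Definition mfibers (I : finType) (K : T -> I) :=
  forall i, measurable (K @^-1` [set i]).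

Lemma mfibers_pair (I J : finType) (K : T -> I) (L : T -> J) :
  mfibers K -> mfibers L -> mfibers (fun w => (K w, L w)).
Proof.
move=> mK mL [i j].
have -> : (fun w => (K w, L w)) @^-1` [set (i, j)] =
    K @^-1` [set i] `&` L @^-1` [set j].
  by apply/seteqP; split=> w /= [-> ->].
exact: measurableI.
Qed.

Lemma indic_fiber (I : finType) (K : T -> I) i w :
  \1_(K @^-1` [set i]) w = (i == K w)%:R :> R.
Proof.
rewrite indicE; congr ((nat_of_bool _)%:R).
apply/idP/eqP => [|->]; last exact: mem_set.
by move=> /set_mem ->.
Qed.

Lemma fiber_sum (I : finType) (K : T -> I) (f : I -> R) w :
  f (K w) = \sum_i f i * \1_(K @^-1` [set i]) w.
Proof.
under eq_bigr do rewrite indic_fiber.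
rewrite (bigD1 (K w))//= eqxx mulr1 big1 ?addr0// => i /negPf ->.
by rewrite mulr0.
Qed.

Lemma fiber_sumE (I : finType) (K : T -> I) (f : I -> R) :
  (fun w => (f (K w))%:E) =
  (fun w => (\sum_i (f i)%:E * (\1_(K @^-1` [set i]) w)%:E)%E).
Proof. by apply/funext => w; rewrite fiber_sum -sumEFin. Qed.

Lemma integrable_fiber (I : finType) (K : T -> I) (f : I -> R) :
  mfibers K -> Pr.-integrable setT (fun w => (f (K w))%:E).
Proof.
move=> mK; rewrite fiber_sumE; apply: integrable_sum => // i _.
by apply: integrableZl => //; exact: integrable_indic.
Qed.

Lemma integral_fiber (I : finType) (K : T -> I) (f : I -> R) : mfibers K ->
  (\int[Pr]_w (f (K w))%:E)%E = (\sum_i f i * pr (K @^-1` [set i]))%:E.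
Proof.
move=> mK; rewrite fiber_sumE integral_sum//; last first.
  by move=> i; apply: integrableZl => //; exact: integrable_indic.
rewrite -sumEFin; apply: eq_bigr => i _.
rewrite integralZl//; last exact: integrable_indic.
by rewrite integral_indic// setIT EFinM prE.
Qed.

Lemma pr_fibers (I : finType) (K : T -> I) B : measurable B -> mfibers K ->
  pr B = \sum_i pr (B `&` K @^-1` [set i]).
Proof.
move=> mB mK; apply: EFin_inj; rewrite prE// -sumEFin.
have mBK i : measurable (B `&` K @^-1` [set i]) by exact: measurableI.
rewrite -[in LHS](setIT B) -integral_indic//.
under eq_integral => w _.
  rewrite (_ : (\1_B w)%:E = \sum_i (\1_(B `&` K @^-1` [set i]) w)%:E)%E.
    over.
  rewrite sumEFin; have /= -> := fiber_sum K (fun=> \1_B w) w.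
  by congr EFin; apply: eq_bigr => i _; rewrite indicI.
rewrite ge0_integral_sum//; last first.
  by move=> i; apply/measurable_EFinP; exact: measurable_indic.
by apply: eq_bigr => i _; rewrite integral_indic// setIT prE.
Qed.
End fibers.

(** * The Markov property of a controlled chain *)

Section markov.
Context (R : realType) (S A : finType) (d : measure_display).
Context (T : measurableType d) (Pr : probability T R).
Context (pi : S -> A -> R) (P : S * A -> S -> R) (s0 : S).
Context (X : nat -> T -> S) (Y : nat -> T -> A).
Hypothesis chain : is_controlled_chain Pr pi P s0 X Y.

Let mX t : mfibers (X t). Proof. by case: chain => mX *; exact: mX. Qed.
Let mY t : mfibers (Y t). Proof. by case: chain => _ mY *; exact: mY. Qed.

(** The cylinder fixing the path from time [k] on; [window 0] is [history].  Going
    from [k] to [k.+1] forgets the pair at time [k], that is, sums over it, so the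
    product formulas for histories descend by induction to the event that only
    the state at time [t] is known. *)
Definition window k t (x : nat -> S) (y : nat -> A) : set T :=
  [set w | (forall i, (k <= i <= t)%N -> X i w = x i) /\
           (forall i, (k <= i < t)%N -> Y i w = y i)].

Lemma windowS_fiber k t x y a b : (k < t)%N ->
  window k.+1 t x y `&` (fun w => (X k w, Y k w)) @^-1` [set (a, b)] =
  window k t (fun i => if i == k then a else x i)
             (fun i => if i == k then b else y i).
Proof.
move=> kt; apply/seteqP; split=> w /=.
  move=> [[hx hy] [Xk Yk]]; split=> i /andP[ki it]; case: eqVneq => [->//|ik].
    by apply: hx; rewrite it ltn_neqAle eq_sym ik ki.
  by apply: hy; rewrite it ltn_neqAle eq_sym ik ki.
move=> [hx hy]; split; first split=> i /andP[ki it].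
- by rewrite hx ?it ?(ltnW ki)// gtn_eqF.
- by rewrite hy ?it ?(ltnW ki)// gtn_eqF.
- by rewrite hx ?hy ?leqnn ?(ltnW kt)// eqxx.
Qed.

Lemma measurable_window k t x y : measurable (window k t x y).
Proof.
rewrite (_ : window k t x y =
  (\bigcap_(i in [set i | (k <= i <= t)%N]) X i @^-1` [set x i]) `&`
  (\bigcap_(i in [set i | (k <= i < t)%N]) Y i @^-1` [set y i])) //.
apply: measurableI; apply: bigcap_measurableType => i _.
  exact: mX.
exact: mY.
Qed.

Lemma pr_windowS k t x y C : (k < t)%N -> measurable C ->
  pr Pr (window k.+1 t x y `&` C) =
  \sum_ab pr Pr (window k t (fun i => if i == k then ab.1 else x i)
             (fun i => if i == k then ab.2 else y i) `&` C).
Proof.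
move=> kt mC; have mW := measurable_window k.+1 t x y.
rewrite (pr_fibers Pr (measurableI _ _ mW mC) (mfibers_pair (mX k) (mY k))).
by apply: eq_bigr => -[a b] _; rewrite setIAC windowS_fiber.
Qed.

Lemma pr_window_action k t x y : (k <= t)%N ->
  pr Pr (window k t x y `&` Y t @^-1` [set y t]) =
  pr Pr (window k t x y) * pi (x t) (y t).
Proof.
elim: k x y => [|k IH] x y kt.
  have mW := measurable_window 0 t x y; case: chain => _ _ _ h _.
  apply: EFin_inj; rewrite EFinM !prE//; first exact: h.
  by apply: measurableI => //; exact: mY.
rewrite pr_windowS//; last exact: mY.
rewrite -[in RHS](setIT (window _ _ _ _)) pr_windowS// mulr_suml.
apply: eq_bigr => -[a b] _; rewrite setIT/=.
have := IH (fun i => if i == k then a else x i)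
           (fun i => if i == k then b else y i) (ltnW kt).
by rewrite gtn_eqF.
Qed.

Lemma pr_window_state k t x y : (k <= t)%N ->
  pr Pr (window k t.+1 x y) =
  pr Pr (window k t x y `&` Y t @^-1` [set y t]) * P (x t, y t) (x t.+1).
Proof.
elim: k x y => [|k IH] x y kt.
  have mW u := measurable_window 0 u x y; case: chain => _ _ _ _ h.
  apply: EFin_inj; rewrite EFinM !prE//; first exact: h.
  by apply: measurableI => //; exact: mY.
rewrite pr_windowS//; last exact: mY.
have kt1 : (k < t.+1)%N := ltnW kt.
rewrite -[window _ t.+1 _ _](setIT _) pr_windowS// mulr_suml.
apply: eq_bigr => -[a b] _; rewrite setIT/=.
have := IH (fun i => if i == k then a else x i)
           (fun i => if i == k then b else y i) (ltnW kt).
by rewrite gtn_eqF// gtn_eqF// ltnW.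
Qed.

Lemma pr_transition t a b c :
  pr Pr ((fun w => (X t w, Y t w, X t.+1 w)) @^-1` [set (a, b, c)]) =
  pr Pr (X t @^-1` [set a]) * pi a b * P (a, b) c.
Proof.
(* Only [x t], [x t.+1] and [y t] are constrained by [window t t.+1 x y]. *)
pose x i := if i == t then a else c; pose y (i : nat) := b.
have xt : x t = a by rewrite /x eqxx.
have xt1 : x t.+1 = c by rewrite /x gtn_eqF.
have -> : (fun w => (X t w, Y t w, X t.+1 w)) @^-1` [set (a, b, c)] =
    window t t.+1 x y.
  apply/seteqP; split=> w /=.
    move=> [Xt Yt Xt1]; split=> i; last by rewrite ltnS -eqn_leq => /eqP <-.
    rewrite leq_eqVlt => /andP[/predU1P[<- _|ti it]]; first by rewrite xt.
    have /eqP -> : i == t.+1 by rewrite eqn_leq it ti.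
    by rewrite xt1.
  by move=> [hx hy]; rewrite hx ?hx ?hy ?leqnn ?leqnSn// xt xt1.
rewrite pr_window_state// pr_window_action// xt xt1; congr (pr _ _ * _ * _).
apply/seteqP; split=> w /=.
  by move=> [hx _]; rewrite -xt hx// leqnn.
move=> Xt; split=> i; first by rewrite -eqn_leq => /eqP <-; rewrite xt.
by case/andP => ti /(leq_ltn_trans ti); rewrite ltnn.
Qed.

Lemma integrable_transition t (f : S -> A -> S -> R) :
  Pr.-integrable setT (fun w => (f (X t w) (Y t w) (X t.+1 w))%:E).
Proof.
exact: (integrable_fiber Pr (fun abc => f abc.1.1 abc.1.2 abc.2)
  (mfibers_pair (mfibers_pair (mX t) (mY t)) (mX t.+1))).
Qed.

Lemma integral_transition t (f : S -> A -> S -> R) :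
  (\int[Pr]_w (f (X t w) (Y t w) (X t.+1 w))%:E)%E =
  (\sum_a pr Pr (X t @^-1` [set a]) *
     \sum_b pi a b * \sum_c P (a, b) c * f a b c)%:E.
Proof.
rewrite (integral_fiber Pr (fun abc => f abc.1.1 abc.1.2 abc.2)
  (mfibers_pair (mfibers_pair (mX t) (mY t)) (mX t.+1))).
pose F a b c := pr Pr (X t @^-1` [set a]) * (pi a b * (P (a, b) c * f a b c)).
rewrite (eq_bigr (fun abc => F abc.1.1 abc.1.2 abc.2)); last first.
  by move=> [[a b] c] _; rewrite pr_transition /F/=; ring.
rewrite -(pair_bigA _ (fun ab c => F ab.1 ab.2 c)).
rewrite -(pair_bigA _ (fun a b => \sum_c F a b c))/=.
congr EFin; apply: eq_bigr => a _; rewrite mulr_sumr; apply: eq_bigr => b _.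
by rewrite !mulr_sumr.
Qed.

Lemma integral_initial (f : S -> R) :
  (\int[Pr]_w (f (X 0%N w))%:E)%E = (f s0)%:E.
Proof.
rewrite (integral_fiber Pr f (mX 0)); congr EFin.
case: chain => _ _ X0 _ _.
have p1 : pr Pr (X 0%N @^-1` [set s0]) = 1 by rewrite /pr X0.
rewrite (bigD1 s0)//= p1 mulr1 big1 ?addr0// => s ns.
suff -> : pr Pr (X 0%N @^-1` [set s]) = 0 by rewrite mulr0.
have tot : \sum_s pr Pr (X 0%N @^-1` [set s]) = 1.
  have := pr_fibers Pr measurableT (mX 0).
  rewrite {1}/pr probability_setT/= => ->.
  by apply: eq_bigr => i _; rewrite setTI.
move: tot; rewrite (bigD1 s0)//= p1 => /(canRL (addKr _)); rewrite addNr => h.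
by have := psumr_eq0P (fun i _ => pr_ge0 Pr _) h (i:=s) ns.
Qed.
End markov.

(** * The expected discounted return *)

Definition is_bellman (R : realType) (S A : finType) (r : S * A -> S -> R)
    (gamma : R) (pi : S -> A -> R) (P : S * A -> S -> R) (u : S -> R) : Prop :=
  forall s, u s =
    \sum_a pi s a * dotp (P (s, a)) (fun s' => r (s, a) s' + gamma * u s').

Section expected_return.
Context (R : realType) (S A : finType) (d : measure_display).
Context (T : measurableType d) (Pr : probability T R).
Context (pi : S -> A -> R) (P : S * A -> S -> R) (s0 : S).
Context (X : nat -> T -> S) (Y : nat -> T -> A).
Hypothesis chain : is_controlled_chain Pr pi P s0 X Y.
Context (r : S * A -> S -> R) (gamma : R) (u : S -> R).
Hypothesis gamma01 : 0 <= gamma < 1.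
Hypothesis bell : is_bellman r gamma pi P u.

(* The expectation of [u (X_t)]. *)
Let U t := \sum_a u a * pr Pr (X t @^-1` [set a]).

Let reward t w := gamma ^+ t * r (X t w, Y t w) (X t.+1 w).

(* The Bellman equation turns the expected reward of a step into a difference of
   discounted expectations of [u], so that partial sums telescope. *)
Let integral_reward t :
  (\int[Pr]_w (reward t w)%:E)%E =
  (gamma ^+ t * U t - gamma ^+ t.+1 * U t.+1)%:E.
Proof.
rewrite (integral_transition chain t (fun a b c => gamma ^+ t * r (a, b) c)).
have mX : mfibers (X t.+1) by case: chain => mX *; exact: mX.
have -> : U t.+1 = \sum_a pr Pr (X t @^-1` [set a]) *
    \sum_b pi a b * \sum_c P (a, b) c * u c.
  apply: EFin_inj; rewrite -(integral_transition chain t (fun a b c => u c)).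
  by rewrite (integral_fiber Pr u mX).
congr EFin; rewrite /U !mulr_sumr -sumrB; apply: eq_bigr => a _.
suff -> : \sum_b pi a b * \sum_c P (a, b) c * (gamma ^+ t * r (a, b) c) =
    gamma ^+ t * (u a - gamma * \sum_b pi a b * \sum_c P (a, b) c * u c).
  by rewrite exprS; ring.
rewrite bell !mulr_sumr -sumrB mulr_sumr; apply: eq_bigr => b _.
by rewrite dotpD dotpZ -!/(dotp _ _) dotpZ; ring.
Qed.

Let norm_U t : `|U t| <= \sum_a `|u a|.
Proof.
apply: le_trans (ler_norm_sum _ _ _) _; apply: ler_sum => a _.
have mXa : measurable (X t @^-1` [set a]) by case: chain => mX *; exact: mX.
rewrite normrM ler_piMr// ger0_norm ?pr_ge0// -lee_fin prE//.
exact: probability_le1.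
Qed.

Let M := \sum_sa \sum_s `|r sa s|.

Let norm_reward t w : `|reward t w| <= M * gamma ^+ t.
Proof.
case/andP: gamma01 => g0 g1.
rewrite normrM ger0_norm ?exprn_ge0// mulrC ler_wpM2r ?exprn_ge0//.
rewrite /M (bigD1 (X t w, Y t w))//= (bigD1 (X t.+1 w))//= -addrA lerDl.
by rewrite addr_ge0// !sumr_ge0// => *; rewrite sumr_ge0.
Qed.

Let M_ge0 : 0 <= M. Proof. by do 2 rewrite sumr_ge0// => *. Qed.

Let cvg_return w : cvgn (series (reward ^~ w)).
Proof.
case/andP: gamma01 => g0 g1.
apply: normed_cvg; apply: (@series_le_cvg _ _ (geometric M gamma)) => [n|n|n|].
- exact: normr_ge0.
- by rewrite mulr_ge0 ?M_ge0 ?exprn_ge0.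
- exact: norm_reward.
- by apply: is_cvg_geometric_series; rewrite ger0_norm.
Qed.

Let norm_return n w : `|series (reward ^~ w) n| <= M / (1 - gamma).
Proof.
case/andP: gamma01 => g0 g1.
apply: (@le_trans _ _ (series (geometric M gamma) n)).
  rewrite /series/=; apply: le_trans (ler_norm_sum _ _ _) _.
  by apply: ler_sum => t _; exact: norm_reward.
rewrite geometric_seriesE ?lt_eqF//= ler_pM2r ?invr_gt0 ?subr_gt0//.
by rewrite ler_piMr ?M_ge0// gerBl exprn_ge0.
Qed.

(** The expected partial returns telescope to [u s0 - gamma^n * U n], which tends
    to [u s0] because [U] is bounded; they also tend to the expected return, by
    dominated convergence with a constant bound. *)
Lemma expected_discounted_return :
  ('E_Pr[discounted_return r gamma X Y])%E = (u s0)%:E.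
Proof.
case/andP: (gamma01) => g0 g1.
have intr t : Pr.-integrable setT (fun w => (reward t w)%:E).
  exact: (integrable_transition chain t (fun a b c => gamma ^+ t * r (a, b) c)).
have ints n : (\int[Pr]_w (series (reward ^~ w) n)%:E)%E =
    (U 0 - gamma ^+ n * U n)%:E.
  rewrite /series/=; under eq_integral do rewrite -sumEFin.
  rewrite integral_sum//; under eq_bigr do rewrite integral_reward.
  rewrite sumEFin; congr EFin.
  elim: n => [|n IH]; first by rewrite big_geq// expr0 mul1r subrr.
  by rewrite big_nat_recr//= IH; ring.
have U0 : U 0 = u s0.
  apply: EFin_inj; rewrite -(integral_initial chain u).
  rewrite (integral_fiber Pr u (K := X 0%N))//.
  by case: chain => mX *; exact: mX.
have lim1 : (\int[Pr]_w (series (reward ^~ w) n)%:E)%E @[n --> \oo] -->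
    ('E_Pr[discounted_return r gamma X Y])%E.
  rewrite unlock.
  apply: (@dominated_cvg _ _ _ Pr setT measurableT _ _
            (cst (M / (1 - gamma))%:E)).
  - move=> n; apply/measurable_EFinP; apply: measurable_sum => t.
    by apply/measurable_EFinP; have /integrableP[] := intr t.
  - by move=> w _; apply: cvg_EFin; [exact: nearW|exact: cvg_return].
  - by [].
  - exact: finite_measure_integrable_cst.
  - by move=> n w _; rewrite lee_fin norm_return.
have lim2 : (\int[Pr]_w (series (reward ^~ w) n)%:E)%E @[n --> \oo] -->
    (u s0)%:E.
  under eq_cvg do rewrite ints.
  apply: cvg_EFin; first exact: nearW.
  rewrite -[X in _ --> X]subr0 U0; apply: cvgB; first exact: cvg_cst.
  apply/norm_cvg0P.
  apply: (@squeeze_cvgr _ _ _ _ (cst 0)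
            (fun n => (\sum_a `|u a|) * gamma ^+ n)).
  - apply: nearW => n; rewrite normr_ge0 normrM mulrC.
    by rewrite (ger0_norm (exprn_ge0 _ g0)) ler_wpM2r ?exprn_ge0 ?norm_U.
  - exact: cvg_cst.
  - by apply: cvg_geometric; rewrite ger0_norm.
exact: cvg_unique lim1 lim2.
Qed.
End expected_return.

(** * Sampling from a uniform variable *)

Section inverse_cdf.
Context (R : realType) (E : finType) (e0 : E).
Implicit Types (p : E -> R) (u : R).

Definition cdf_upto p k : R := \sum_(f | (enum_rank f < k)%N) p f.

(** The unit interval is cut into consecutive cells of lengths [p e], in the order
    of the enumeration of [E]; [draw] reads off the cell of [u], and [resid]
    rescales the position of [u] in its cell to the unit interval. *)
Definition cell p e u : bool :=
  cdf_upto p (enum_rank e) <= u < cdf_upto p (enum_rank e) + p e.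

Definition draw p u : E := odflt e0 [pick e | cell p e u].

Definition resid p u : R :=
  (u - cdf_upto p (enum_rank (draw p u))) / p (draw p u).

Lemma cdf_uptoS p e :
  cdf_upto p (enum_rank e).+1 = cdf_upto p (enum_rank e) + p e.
Proof.
rewrite /cdf_upto (bigD1 e)//= addrC; congr (_ + _); apply: eq_bigl => f.
rewrite ltnS ltn_neqAle andbC; congr andb.
by rewrite (inj_eq val_inj) (inj_eq enum_rank_inj).
Qed.

Lemma cdf_upto0 p : cdf_upto p 0 = 0.
Proof. by rewrite /cdf_upto big_pred0. Qed.

Section dist.
Context (p : E -> R).
Hypothesis dp : is_dist p.

Lemma le_cdf_upto k l : (k <= l)%N -> cdf_upto p k <= cdf_upto p l.
Proof.
case: dp => p0 _ kl; rewrite /cdf_upto big_mkcond [leRHS]big_mkcond/=.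
apply: ler_sum => f _; case: ltnP => [fk|_]; first by rewrite (leq_trans fk).
by case: ifP.
Qed.

Lemma cdf_upto_card : cdf_upto p #|E| = 1.
Proof. by case: dp => _ <-; apply: eq_bigl => f; exact: ltn_ord. Qed.

Lemma cdf_upto_ge0 k : 0 <= cdf_upto p k.
Proof. by rewrite -(cdf_upto0 p) le_cdf_upto. Qed.

Lemma cell_le1 e : cdf_upto p (enum_rank e) + p e <= 1.
Proof. by rewrite -cdf_uptoS -cdf_upto_card le_cdf_upto. Qed.

Lemma cell_inj e f u : cell p e u -> cell p f u -> e = f.
Proof.
have aux (e' f' : E) : cell p e' u -> cell p f' u ->
    ~~ (enum_rank e' < enum_rank f')%N.
  rewrite /cell -!cdf_uptoS => /andP[_ h1] /andP[h2 _].
  apply/negP => /le_cdf_upto h3.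
  by have := lt_le_trans h1 (le_trans h3 h2); rewrite ltxx.
move=> he hf; apply: enum_rank_inj; apply/val_inj/eqP.
by rewrite eqn_leq leqNgt aux//= leqNgt aux.
Qed.

Lemma cell_exists u : 0 <= u < 1 -> exists e, cell p e u.
Proof.
move=> /andP[u0 u1].
have ex : exists k, u < cdf_upto p k by exists #|E|; rewrite cdf_upto_card.
case: (ex_minnP ex) => -[|k] uk kmin.
  by move: uk; rewrite cdf_upto0 ltNge u0.
have kE : (k < #|E|)%N by apply: kmin; rewrite cdf_upto_card.
exists (enum_val (Ordinal kE)).
rewrite /cell -cdf_uptoS enum_valK/= uk andbT leNgt; apply/negP => /kmin.
by rewrite ltnn.
Qed.

Lemma cell_draw u : 0 <= u < 1 -> cell p (draw p u) u.
Proof.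
move=> /cell_exists[e eu]; rewrite /draw; case: pickP => [//|/(_ e)].
by rewrite eu.
Qed.

Lemma drawE e u : 0 <= u < 1 -> (draw p u == e) = cell p e u.
Proof.
move=> u01; have cu := cell_draw u01.
by apply/eqP/idP => [<-//|]; exact: cell_inj.
Qed.

Lemma draw_gt0 u : 0 <= u < 1 -> 0 < p (draw p u).
Proof.
move=> /cell_draw/andP[h1 h2]; have := le_lt_trans h1 h2.
by rewrite ltrDl.
Qed.

Lemma resid01 u : 0 <= u < 1 -> 0 <= resid p u < 1.
Proof.
move=> u01; have p0 := draw_gt0 u01; have /andP[h1 h2] := cell_draw u01.
by rewrite /resid divr_ge0 ?subr_ge0 ?(ltW p0)//= ltr_pdivrMr// mul1r ltrBlDl.
Qed.

End dist.
End inverse_cdf.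

(** * One random transition *)

Section sampling_step.
Context (R : realType) (d : measure_display) (T : measurableType d).
Context (Pr : probability T R).

Lemma measurable_fiberwise (I : finType) (K : T -> I) B :
  (forall i, measurable (B `&` K @^-1` [set i])) -> measurable B.
Proof.
move=> mB; rewrite (_ : B = \big[setU/set0]_i (B `&` K @^-1` [set i])).
  by apply: bigsetU_measurable => i _.
apply/seteqP; split=> [w Bw|w].
  by rewrite (bigD1 (K w))//=; left.
by elim/big_ind: _ => //= [C D hC hD [/hC|/hD]|i _ []].
Qed.

(** Conditionally on [B], [u] is uniform on the unit interval; the product form
    also covers the events [B] of probability zero. *)
Definition cond_uniform (B : set T) (u : T -> R) := forall a b,
  0 <= a -> a <= b -> b <= 1 ->
  pr Pr (B `&` [set w | a <= u w < b]) = pr Pr B * (b - a).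

Lemma measurable_between (u : T -> R) a b :
  measurable_fun setT u -> measurable [set w | a <= u w < b].
Proof.
move=> mu; rewrite (_ : mkset _ = setT `&` u @^-1` [set` `[a, b[]); last first.
  by rewrite setTI; apply/seteqP; split=> w /=; rewrite in_itv.
by apply: mu.
Qed.

Context (I E : finType) (e0 : E) (K : T -> I) (p : I -> E -> R) (u : T -> R).
Hypotheses (mK : mfibers K) (dp : forall i, is_dist (p i)).
Hypotheses (mu : measurable_fun setT u) (u01 : forall w, 0 <= u w < 1).

(** When [K] is the current position of the chain and [u] is uniform given the
    past, [draw_step] is the next position, drawn from [p (K w)], and
    [resid_step] the randomness left for later draws. *)
Definition draw_step w := draw e0 (p (K w)) (u w).
Definition resid_step w := resid e0 (p (K w)) (u w).

Lemma resid_step01 w : 0 <= resid_step w < 1.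
Proof. exact: resid01. Qed.

Lemma mfibers_draw_step : mfibers draw_step.
Proof.
move=> e; apply: (measurable_fiberwise (K := K)) => i.
rewrite (_ : _ `&` _ = K @^-1` [set i] `&` [set w | cell (p i) e (u w)]).
  by apply: measurableI => //; exact: measurable_between.
apply/seteqP; split=> w /=.
  by move=> [<- <-]; split=> //; exact: cell_draw.
by move=> [<- c]; split=> //; apply/eqP; rewrite drawE.
Qed.

Lemma measurable_resid_step : measurable_fun setT resid_step.
Proof.
move=> _ D mD; rewrite setTI.
have mKL := mfibers_pair mK mfibers_draw_step.
apply: (measurable_fiberwise (K := fun w => (K w, draw_step w))) => -[i e].
pose f w := (u w - cdf_upto (p i) (enum_rank e)) / p i e.
rewrite (_ : _ `&` _ =
  (setT `&` f @^-1` D) `&` (fun w => (K w, draw_step w)) @^-1` [set (i, e)]).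
  apply: measurableI => //.
  have mf : measurable_fun setT f.
    by apply: measurable_funM => //; apply: measurable_funB.
  by apply: mf.
rewrite setTI; apply/seteqP; split=> w /=; rewrite /resid_step /resid /f.
  by move=> [h [<- <-]].
by move=> [h [Ki Le]]; move: h; rewrite -Ki -Le.
Qed.

Context (B : set T) (i : I).
Hypotheses (mB : measurable B) (BK : forall w, B w -> K w = i).
Hypothesis uB : cond_uniform B u.

Let draw_stepI e : B `&` draw_step @^-1` [set e] =
  B `&` [set w | cell (p i) e (u w)].
Proof.
apply/seteqP; split=> w /= [Bw h]; split=> //.
  by rewrite -h /draw_step BK//; exact: cell_draw.
by apply/eqP; rewrite /draw_step BK// drawE.
Qed.

Lemma pr_draw_step e :
  pr Pr (B `&` draw_step @^-1` [set e]) = pr Pr B * p i e.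
Proof.
rewrite draw_stepI uB ?cdf_upto_ge0 ?cell_le1//; first by congr (_ * _); ring.
by rewrite lerDl; case: (dp i).
Qed.

(** Given that the draw is [e], [u] is uniform on the cell of [e], so its rescaling
    is uniform on the unit interval: the randomness never runs out. *)
Lemma resid_step_uniform e :
  cond_uniform (B `&` draw_step @^-1` [set e]) resid_step.
Proof.
move=> a b a0 ab b1; rewrite pr_draw_step.
have mBd : measurable (B `&` draw_step @^-1` [set e]).
  by apply: measurableI => //; exact: mfibers_draw_step.
have pe0 : 0 <= p i e by case: (dp i).
have [pe|pe] := eqVneq (p i e) 0.
  apply/eqP; rewrite pe mulr0 mul0r eq_le pr_ge0 andbT.
  rewrite -[X in _ <= X](mulr0 (pr Pr B)) -pe -pr_draw_step -lee_fin.
  have mr := measurable_between a b measurable_resid_step.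
  by rewrite !prE//; [apply: measureIl|exact: measurableI].
have {pe0}pe : 0 < p i e by rewrite lt_neqAle eq_sym pe.
set c := cdf_upto (p i) (enum_rank e).
rewrite (_ : _ `&` _ `&` _ =
    B `&` [set w | c + a * p i e <= u w < c + b * p i e]); last first.
  rewrite draw_stepI; apply/seteqP; split=> w /=.
    move=> [[Bw ce]]; have /eqP de : draw_step w == e.
      by rewrite /draw_step BK// drawE.
    rewrite /resid_step /resid -/(draw_step w) de BK// -/c.
    by rewrite ler_pdivlMr// ltr_pdivrMr// lerBrDl ltrBlDl.
  move=> [Bw /andP[h1 h2]].
  have ce : cell (p i) e (u w).
    rewrite /cell -/c (le_trans _ h1) ?lerDl ?mulr_ge0 ?(ltW pe)//=.
    by rewrite (lt_le_trans h2)// lerD2l ler_piMl// ltW.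
  split=> //; have /eqP de : draw_step w == e.
    by rewrite /draw_step BK// drawE.
  rewrite /resid_step /resid -/(draw_step w) de BK// -/c.
  by rewrite ler_pdivlMr// ltr_pdivrMr// lerBrDl ltrBlDl h1.
rewrite uB.
- ring.
- by rewrite addr_ge0 ?cdf_upto_ge0// mulr_ge0// ltW.
- by rewrite lerD2l ler_wpM2r// ltW.
- by apply: le_trans (cell_le1 (dp i) e); rewrite lerD2l ler_piMl// ltW.
Qed.

End sampling_step.

(** * Existence of a controlled chain *)

Section uniform_variable.
Context (R : realType).

Let Pr : probability (measurableTypeR R) R := uniform_prob (@ltr01 R).

(* The uniform law lives on the closed unit interval of the whole line; the
   variable is moved to [0] off the half-open one, where the sampler needs it to
   be at every point. *)
Let U (w : measurableTypeR R) : R := if 0 <= w < 1 then w else 0.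

Let U01 w : 0 <= U w < 1.
Proof. by rewrite /U; case: ifP => // _; rewrite lexx ltr01. Qed.

Let mU : measurable_fun setT U.
Proof.
apply: measurable_fun_if => //.
apply: measurable_and => //; first exact: measurable_fun_ler.
exact: measurable_fun_ltr.
Qed.

Let pr_itv (a b : R) : 0 <= a -> a <= b -> b <= 1 -> pr Pr `[a, b[ = b - a.
Proof.
move=> a0 ab b1; rewrite /pr /Pr/= /uniform_prob integral_uniform_pdf.
rewrite setIidl; last first.
  move=> x /=; rewrite !in_itv/= => /andP[ax xb].
  by rewrite (le_trans a0 ax) (le_trans (ltW xb) b1).
rewrite (eq_integral (cst 1%E)); last first.
  move=> x; rewrite inE/= in_itv/= /uniform_pdf => /andP[ax xb].
  by rewrite (le_trans a0 ax) (le_trans (ltW xb) b1) subr0 invr1.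
rewrite integral_cst//= mul1e lebesgue_measure_itv/= lte_fin.
by case: ltP => //= ba; apply/eqP; rewrite eq_sym subr_eq0 eq_le ab ba.
Qed.

(** [U] is the identity on the half-open unit interval, and the complement of that
    interval is negligible. *)
Lemma uniform_variable_exists : exists (d : measure_display)
    (T : measurableType d) (Q : probability T R) (V : T -> R),
  [/\ measurable_fun setT V, forall w, 0 <= V w < 1 & cond_uniform Q setT V].
Proof.
exists _, (measurableTypeR R), Pr, U; split=> // a b a0 ab b1.
rewrite setTI {2}/pr probability_setT mul1r.
pose K (w : measurableTypeR R) : bool := 0 <= w < 1.
have KT : K @^-1` [set true] = `[0, 1[%classic.
  by apply/seteqP; split=> w /=; rewrite in_itv.
have mK : mfibers K.
  case; first by rewrite KT; exact: measurable_itv.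
  rewrite (_ : K @^-1` _ = ~` K @^-1` [set true]); last first.
    by apply/seteqP; split=> w /=; case: (K w).
  by apply: measurableC; rewrite KT; exact: measurable_itv.
have mD : measurable [set w | a <= U w < b] by exact: measurable_between.
rewrite (pr_fibers Pr mD mK) big_bool/=.
have -> : [set w | a <= U w < b] `&` K @^-1` [set true] = `[a, b[%classic.
  apply/seteqP; split=> w /=; rewrite in_itv/= /U /K.
    by move=> [h k]; move: h; rewrite k.
  move=> /andP[aw wb]; have -> : 0 <= w < 1.
    by rewrite (le_trans a0 aw) (lt_le_trans wb b1).
  by rewrite aw wb.
rewrite pr_itv//.
suff -> : pr Pr ([set w | a <= U w < b] `&` K @^-1` [set false]) = 0.
  by rewrite addr0.
have t1 := pr_fibers Pr measurableT mK.
apply/eqP; rewrite eq_le pr_ge0 andbT.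
have -> : 0 = pr Pr (K @^-1` [set false]).
  move: t1; rewrite big_bool/= !setTI KT pr_itv//.
  rewrite {1}/pr probability_setT subr0 => h.
  by apply: (addrI 1); rewrite addr0.
rewrite -lee_fin !prE//; last exact: measurableI.
by apply: measureIr => //; exact: mK.
Qed.
End uniform_variable.

Section controlled_chain.
Context (R : realType) (S A : finType) (s0 : S) (a0 : A).
Context (pi : S -> A -> R) (P : S * A -> S -> R).
Hypotheses (dpi : forall s, is_dist (pi s)).
Hypotheses (dP : forall sa, is_dist (P sa)).
Context (d : measure_display) (T : measurableType d) (Pr : probability T R).
Context (U : T -> R).
Hypotheses (mU : measurable_fun setT U) (U01 : forall w, 0 <= U w < 1).
Hypothesis uU : cond_uniform Pr setT U.

(** The state at time [t] together with the randomness left at that time: each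
    transition draws an action and then a state. *)
Fixpoint chain_state t : (T -> S) * (T -> R) :=
  if t is t'.+1 then
    let X := (chain_state t').1 in
    let V := (chain_state t').2 in
    let XY w := (X w, draw_step a0 X pi V w) in
    let W := resid_step a0 X pi V in
    (draw_step s0 XY P W, resid_step s0 XY P W)
  else (fun=> s0, U).

Let X t := (chain_state t).1.
Let V t := (chain_state t).2.
Let Y t := draw_step a0 (X t) pi (V t).
Let W t := resid_step a0 (X t) pi (V t).
Let XY t w := (X t w, Y t w).

Let XS t : X t.+1 = draw_step s0 (XY t) P (W t).
Proof. by []. Qed.

Let VS t : V t.+1 = resid_step s0 (XY t) P (W t).
Proof. by []. Qed.

Let invariant t : [/\ mfibers (X t), measurable_fun setT (V t) &
  forall w, 0 <= V t w < 1].
Proof.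
elim: t => [|t [mX mV V01]].
  by split=> // s; rewrite /X/= preimage_cst; case: ifP.
have mXY : mfibers (XY t).
  by apply: mfibers_pair => //; exact: mfibers_draw_step.
have mW : measurable_fun setT (W t) by exact: measurable_resid_step.
have W01 w : 0 <= W t w < 1 by exact: resid_step01.
rewrite XS VS; split; [exact: mfibers_draw_step|exact: measurable_resid_step|].
by move=> w; exact: resid_step01.
Qed.

Let mX t : mfibers (X t). Proof. by case: (invariant t). Qed.
Let mV t : measurable_fun setT (V t). Proof. by case: (invariant t). Qed.
Let V01 t w : 0 <= V t w < 1. Proof. by case: (invariant t). Qed.
Let mY t : mfibers (Y t). Proof. exact: mfibers_draw_step. Qed.
Let mW t : measurable_fun setT (W t). Proof. exact: measurable_resid_step. Qed.
Let W01 t w : 0 <= W t w < 1. Proof. exact: resid_step01. Qed.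
Let mXY t : mfibers (XY t). Proof. exact: mfibers_pair. Qed.

Let history0 x y : history X Y 0 x y = [set _ | x 0%N = s0].
Proof.
apply/seteqP; split=> w /=; first by move=> [/(_ _ (leqnn 0)) <-].
by move=> x0; split=> // i; rewrite leqn0 => /eqP ->.
Qed.

Let historyS t x y : history X Y t.+1 x y =
  (history X Y t x y `&` Y t @^-1` [set y t]) `&` X t.+1 @^-1` [set x t.+1].
Proof.
apply/seteqP; split=> w /=.
  move=> [hx hy]; split; last exact: hx.
  by split; [split=> i it; [apply: hx|apply: hy]; exact: leqW|exact: hy].
move=> [[[hx hy] Yt] Xt]; split=> i.
  by rewrite leq_eqVlt => /predU1P[->//|]; rewrite ltnS; exact: hx.
by rewrite ltnS leq_eqVlt => /predU1P[->//|]; exact: hy.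
Qed.

Let measurable_history t x y : measurable (history X Y t x y).
Proof.
elim: t => [|t IH].
  rewrite history0; have [->|xs] := eqVneq (x 0%N) s0.
    rewrite (_ : mkset _ = setT)//; exact/seteqP.
  rewrite (_ : mkset _ = set0)//.
  by apply/seteqP; split=> w // /eqP; rewrite (negPf xs).
rewrite historyS; apply: measurableI; last exact: mX.
by apply: measurableI => //; exact: mY.
Qed.

(* The invariant of the construction: what is left of the initial uniform
   variable at time [t] is uniform given the history. *)
Let history_uniform t x y : cond_uniform Pr (history X Y t x y) (V t).
Proof.
elim: t => [|t IH].
  rewrite history0; have [->|xs] := eqVneq (x 0%N) s0.
    by rewrite (_ : mkset _ = setT)//; exact/seteqP.
  rewrite (_ : mkset _ = set0); last first.
    by apply/seteqP; split=> w // /eqP; rewrite (negPf xs).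
  by move=> a b _ _ _; rewrite set0I /pr measure0 mul0r.
rewrite historyS VS XS.
apply: (resid_step_uniform s0 (mXY t) dP (mW t) (W01 t)
          (i := (x t, y t))) => //.
- apply: measurableI; [exact: measurable_history|exact: mY].
- by move=> w /= [[hx _] <-]; rewrite /XY hx.
- apply: (resid_step_uniform a0 (mX t) dpi (mV t) (V01 t) (i := x t)) => //.
  by move=> w [hx _]; exact: hx.
Qed.

Lemma controlled_chain_of_uniform :
  exists X Y, is_controlled_chain Pr pi P s0 X Y.
Proof.
exists X, Y; split.
- by move=> t x; exact: mX.
- by move=> t a; exact: mY.
- rewrite (_ : _ @^-1` _ = setT) ?probability_setT//.
  by apply/seteqP.
- move=> t x y; have mH := measurable_history t x y.
  have mHY : measurable (history X Y t x y `&` Y t @^-1` [set y t]).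
    by apply: measurableI => //; exact: mY.
  rewrite -(prE Pr mH) -(prE Pr mHY) -EFinM; congr EFin.
  apply: (pr_draw_step a0 dpi (V01 t) (i := x t)) => //.
  by move=> w [hx _]; exact: hx.
- move=> t x y; have mH := measurable_history t.+1 x y.
  have mHY : measurable (history X Y t x y `&` Y t @^-1` [set y t]).
    by apply: measurableI => //; exact: mY.
  rewrite -(prE Pr mH) -(prE Pr mHY) -EFinM historyS XS; congr EFin.
  apply: (pr_draw_step s0 dP (W01 t) (i := (x t, y t))) => //.
    by move=> w /= [[hx _] <-]; rewrite /XY hx.
  apply: (resid_step_uniform a0 (mX t) dpi (mV t) (V01 t) (i := x t)) => //.
  by move=> w [hx _]; exact: hx.
Qed.

End controlled_chain.

(** * The value function and the Bellman equation *)

Section value_function.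
Context (R : realType) (S A : finType).
Context (r : S * A -> S -> R) (gamma : R) (pi : S -> A -> R).
Hypotheses (gamma01 : 0 <= gamma < 1) (dpi : is_policy pi).

(** Every chain has expected return [u], and there is one; in particular a Bellman
    solution is unique. *)
Lemma value_eq (P : S * A -> S -> R) u : (0 < #|A|)%N -> is_kernel P ->
  is_bellman r gamma pi P u -> value r gamma pi P = u.
Proof.
move=> /card_gt0P[a0 _] dP bu; apply/funext => s.
have [d [T [Pr [V [mV V01 uV]]]]] := uniform_variable_exists R.
have [X [Y XY]] := controlled_chain_of_uniform s a0 dpi dP mV V01 uV.
apply: xget_unique.
  exists d, T, Pr, X, Y; split=> //.
  exact: (expected_discounted_return XY gamma01 bu).
move=> v [d' [T' [Pr' [X' [Y' [XY' Ev]]]]]]; apply: EFin_inj.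
by rewrite -Ev; exact: (expected_discounted_return XY' gamma01 bu).
Qed.

Lemma is_uhat_bellman (PP : set (transitions R S A)) u P : PP P ->
  is_uhat PP r gamma pi u ->
  (forall sa Q, PP Q -> dotp (P sa) (fun s' => r sa s' + gamma * u s') <=
                        dotp (Q sa) (fun s' => r sa s' + gamma * u s')) ->
  is_bellman r gamma pi P u.
Proof.
move=> PPP hu Pmin s; have [m mmin ->] := hu s; apply: eq_bigr => a _.
have [[Q PQ <-] lb] := mmin a; congr (_ * _).
by apply/eqP; rewrite eq_le lb ?Pmin//; exists P.
Qed.

(** The robust equation for the uncertainty set [[set P]] is the Bellman equation
    of [P]. *)
Lemma bellman_exists (P : transitions R S A) : is_kernel P ->
  exists u, is_bellman r gamma pi P u.
Proof.
move=> dP; have [|||||u hu] := @is_uhat_exists R S A [set P] _ _ _ r gamma pi.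
- by move=> _ ->.
- by exists P.
- exact: compact_set1.
- exact: gamma01.
- exact: dpi.
- by exists u; apply: (is_uhat_bellman _ hu) => // sa _ ->.
Qed.

(** At a state where [u - v] is largest, the two one-step inequalities bound this
    maximum by [gamma] times itself; hence it is nonpositive. *)
Lemma bellman_comparison (P : S * A -> S -> R) u v : is_kernel P ->
  (forall s, u s <=
    \sum_a pi s a * dotp (P (s, a)) (fun s' => r (s, a) s' + gamma * u s')) ->
  is_bellman r gamma pi P v -> forall s, u s <= v s.
Proof.
move=> dP hu hv s1; case/andP: gamma01 => g0 g1.
case: (@arg_maxP _ _ _ s1 xpredT (fun s => u s - v s)) => // s _ smax.
suff us : u s - v s <= 0.
  by have := smax s1 isT; rewrite -subr_le0 => /le_trans; apply.
suff h : u s - v s <= gamma * (u s - v s).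
  by rewrite -(@pmulr_rle0 _ (1 - gamma)) ?subr_gt0// mulrBl mul1r subr_le0.
rewrite lerBlDr (le_trans (hu s))// [in leRHS]addrC.
rewrite [v s in X in _ <= X + _]hv.
rewrite -[X in _ <= _ + X](dotp_cst _ (dpi s)) -dotpD; apply: ler_dotp => // a.
rewrite -[X in _ <= _ + X](dotp_cst _ (dP (s, a))) -dotpD.
apply: ler_dotp => // s'.
rewrite -addrA lerD2l -mulrDr ler_wpM2l// -lerBlDl.
exact: smax.
Qed.

End value_function.

Unset Implicit Arguments.
Set Strict Implicit.

Theorem theorem3 (R : realType) (S A : finType)
    (S_nonempty : (0 < #|S|)%N) (A_nonempty : (0 < #|A|)%N)
    (PP : set (transitions R S A))
    (PP_kernels : forall P, PP P -> is_kernel P)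
    (PP_nonempty : PP !=set0) (PP_compact : compact PP) :
  [<->
    sa_tractable PP;
    forall (pi : S -> A -> R) (r : S * A -> S -> R) (gamma : R),
      is_policy pi -> 0 <= gamma < 1 ->
      exists2 P, PP P & uhat PP r gamma pi = value r gamma pi P;
    forall V : S * A -> S -> R,
      \bigcap_(sa in [set: S * A])
        argmin PP (fun P => dotp (P sa) (V sa)) !=set0].
Proof.
have uhatP r gamma pi : is_policy pi -> 0 <= gamma < 1 ->
    is_uhat PP r gamma pi (uhat PP r gamma pi).
  move=> dpi g01.
  exact: xgetPex (is_uhat_exists PP_kernels PP_nonempty PP_compact r g01 dpi).
have valueP r gamma pi P : is_policy pi -> 0 <= gamma < 1 -> PP P ->
    is_bellman r gamma pi P (value r gamma pi P).
  move=> dpi g01 /PP_kernels dP.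
  have [u bu] := bellman_exists r g01 dpi dP.
  by rewrite (value_eq g01 dpi A_nonempty dP bu).
have uhat_le r gamma pi P : is_policy pi -> 0 <= gamma < 1 -> PP P ->
    forall s, uhat PP r gamma pi s <= value r gamma pi P s.
  move=> dpi g01 PPP.
  apply: (bellman_comparison g01 dpi (PP_kernels _ PPP) _
            (valueP _ _ _ _ dpi g01 PPP)) => s.
  have [m mmin {1}->] := uhatP r _ _ dpi g01 s.
  apply: ler_sum => a _; apply: ler_wpM2l; first by case: (dpi s).
  by have [_ lb] := mmin a; apply: lb; exists P.
tfae.
- move=> tract pi r gamma dpi g01.
  pose mu (_ : S) : R := (#|S|%:R)^-1.
  have mu0 s : 0 < mu s by rewrite invr_gt0 ltr0n.
  have [[P PPP Pmin] _] :=
    tract pi r gamma mu dpi g01 (uniform_dist R S_nonempty).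
  exists P => //; apply/funext => s.
  by apply: (eq_dotp_full mu0 (uhat_le _ _ _ _ dpi g01 PPP) (esym Pmin)).
- move=> attained V.
  pose pi (_ : S) (_ : A) : R := (#|A|%:R)^-1.
  have dpi : is_policy pi by move=> s; exact: uniform_dist.
  have g01 : 0 <= (0 : R) < 1 by rewrite lexx ltr01.
  have [P PPP uv] := attained pi V 0 dpi g01.
  exists P => -[s a] _; split=> // Q PQ.
  have V0 (w : S -> R) sa : (fun s' => V sa s' + 0 * w s') = V sa.
    by apply/funext => s'; rewrite mul0r addr0.
  have pi0 b : 0 < pi s b by rewrite invr_gt0 ltr0n.
  have [m mmin um] := uhatP V 0 pi dpi g01 s.
  have mle b : m b <= dotp (P (s, b)) (V (s, b)).
    by have [_ lb] := mmin b; apply: lb; exists P => //; rewrite V0.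
  have <- : m a = dotp (P (s, a)) (V (s, a)).
    apply: (eq_dotp_full pi0 mle).
    rewrite /dotp -um uv (valueP V 0 pi P dpi g01 PPP s).
    by apply: eq_bigr => b _; rewrite V0.
  by have [_ lb] := mmin a; apply: lb; exists Q => //; rewrite V0.
- move=> common pi r gamma mu dpi g01 dmu.
  pose u := uhat PP r gamma pi.
  have [P hP] := common (fun sa s' => r sa s' + gamma * u s').
  case/card_gt0P: S_nonempty => s1 _; case/card_gt0P: (A_nonempty) => a1 _.
  have PPP : PP P by have [] := hP (s1, a1) I.
  have uv : value r gamma pi P = u.
    apply: value_eq => //; first exact: PP_kernels.
    apply: (is_uhat_bellman PPP); first exact: uhatP.
    by move=> sa Q PQ; have [_] := hP sa I; apply.
  split; first by exists P => //; rewrite uv.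
  move=> _ [Q PQ <-]; apply: ler_dotp => // s; exact: uhat_le.
Qed.
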